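(* Let $f : \mathcal{X} \to \{-1,1\}$ be a function and let $\alpha > 0$. Let $d$ be a distance (metric) in $\mathcal{X}$ bounded by $D > 0$, i.e. $d(x,y) \le D$ for all $x,y \in \mathcal{X}$. Define $l_\alpha(x) = f(x)\, d(x, A_x)^{\alpha}$ for all $x \in \mathcal{X}$, where $A_x = \{ y \in \mathcal{X} : f(y) \neq f(x)\}$. Then, for all $x, y \in \mathcal{X}$: \begin{itemize} \item if $\alpha \le 1$, then $|l_\alpha(x) - l_\alpha(y)| \le 2\, d(x,y)^{\alpha}$; \item if $\alpha \ge 1$, then $|l_\alpha(x) - l_\alpha(y)| \le 2 \alpha D^{\alpha - 1}\, d(x,y)$. \end{itemize}
   Context: $\mathcal{X}$ is a set. For a point $x \in \mathcal{X}$ and a subset $A \subseteq \mathcal{X}$, $d(x,A) = \inf_{z \in A} d(x,z)$ denotes the distance from $x$ to $A$. *)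

(* Defs.v *)
From HB Require Import structures.
From mathcomp Require Import all_boot all_order all_algebra.
From mathcomp Require Import all_classical all_reals all_analysis.

Set Implicit Arguments.
Unset Strict Implicit.
Unset Printing Implicit Defensive.

Import Order.TTheory GRing.Theory Num.Theory.

Local Open Scope classical_set_scope.
Local Open Scope ring_scope.

(* [inf] is real-valued and [inf set0 = 0], so [point_set_dist x set0 = 0]. *)
Definition point_set_dist {R : realType} {X : metricType R}
    (x : X) (A : set X) : R :=
  inf [set mdist x z | z in A].

Definition other_class {R : realType} {X : metricType R}
    (f : X -> R) (x : X) : set X :=
  [set y | f y <> f x].

(* If [f] is constant, every [other_class f x] is empty and
   [signed_dist_pow f alpha] vanishes everywhere for [alpha > 0]. *)
Definition signed_dist_pow {R : realType} {X : metricType R}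
    (f : X -> R) (alpha : R) (x : X) : R :=
  f x * point_set_dist x (other_class f x) `^ alpha.

(* Main.v *)
Require Import Defs.
From HB Require Import structures.
From mathcomp Require Import all_boot all_order all_algebra.
From mathcomp Require Import all_classical all_reals all_analysis.
From mathcomp Require Import ring lra.

Set Implicit Arguments.
Unset Strict Implicit.
Unset Printing Implicit Defensive.

Import Order.TTheory GRing.Theory Num.Theory.

Local Open Scope classical_set_scope.
Local Open Scope ring_scope.

(** If [f x = f y], then [A_x = A_y] and [d(., A_x)] is 1-Lipschitz, so the
    bounds reduce to estimates of [|u^alpha - v^alpha|] for [u, v] in [[0, D]]:
    subadditivity of the power for [alpha <= 1], convexity for [alpha >= 1].
    If [f x <> f y], then each of [x], [y] lies in the other's opposite class,
    so both distances to these classes are at most [d(x, y)] and the two terms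
    are bounded separately. *)

(** Put [s = a + b]. A ratio [c / s] in [0, 1] is at most its own power of exponent [p <= 1], so
    [c / s * s^p <= c^p]; adding the cases [c = a] and [c = b] gives the claim, since the two ratios
    sum to 1. *)
Lemma powR_addr_le (R : realType) (p a b : R) : 0 < p -> p <= 1 ->
  0 <= a -> 0 <= b -> (a + b) `^ p <= a `^ p + b `^ p.
Proof.
move=> p0 p1 a0 b0.
have [s0|s0] := leP (a + b) 0.
  have -> : a = 0 by lra.
  have -> : b = 0 by lra.
  by rewrite addr0 lerDl powR_ge0.
have frac_le (c : R) : 0 <= c -> c <= a + b ->
    c / (a + b) * (a + b) `^ p <= c `^ p.
  move=> c0 cs.
  have [->|cN0] := eqVneq c 0; first by rewrite !mul0r powR_ge0.
  have cs0 : 0 < c / (a + b) by rewrite divr_gt0// lt_def cN0.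
  have cp : c / (a + b) <= (c / (a + b)) `^ p.
    by rewrite ger1_powR// cs0 ler_pdivrMr// mul1r.
  apply: (le_trans (ler_wpM2r (powR_ge0 _ _) cp)).
  by rewrite -powRM ?(ltW cs0) ?(ltW s0)// divfK// gt_eqF.
have ha := frac_le a a0 ltac:(lra).
have hb := frac_le b b0 ltac:(lra).
have -> : (a + b) `^ p =
    a / (a + b) * (a + b) `^ p + b / (a + b) * (a + b) `^ p.
  by rewrite -mulrDl -mulrDl divff ?mul1r// gt_eqF.
exact: lerD.
Qed.

(** By symmetry [v <= u]; then subadditivity is applied to the splitting [u = (u - v) + v]. *)
Lemma powR_dist_le (R : realType) (p u v : R) : 0 < p -> p <= 1 ->
  0 <= u -> 0 <= v -> `|u `^ p - v `^ p| <= `|u - v| `^ p.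
Proof.
move=> p0 p1; wlog vu : u v / v <= u => [hw|] u0 v0.
  have [/hw|/ltW/hw] := leP v u; first exact.
  by rewrite (distrC (u `^ p)) (distrC u); exact.
rewrite !ger0_norm ?subr_ge0//; last by rewrite ge0_ler_powR ?nnegrE// ltW.
have := powR_addr_le p0 p1 (_ : 0 <= u - v) v0.
by rewrite subr_ge0 subrK lerBlDr; exact.
Qed.

(* The tangent inequality of the convex power function at [u]; it is Young's
   inequality for [v] and [u^(p-1)] with exponents [p] and [p/(p-1)]. *)
Lemma powR_sub_le_tangent (R : realType) (p u v : R) : 1 <= p ->
  0 <= u -> 0 <= v -> u `^ p - v `^ p <= p * u `^ (p - 1) * (u - v).
Proof.
move=> p1 u0 v0; have p0 : 0 < p by lra.
(* The exponent [p / (p - 1)] makes sense only for [p > 1]; at [p = 1] both sides equal [u - v]. *)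
have [->|pN1] := eqVneq p 1; first by rewrite subrr powRr0 !mul1r !powRr1.
have p10 : 0 < p - 1 by rewrite subr_gt0 lt_def pN1.
have qE : p^-1 + (p / (p - 1))^-1 = 1.
  by field; rewrite ?gt_eqF.
have := conjugate_powR v0 (powR_ge0 u (p - 1)) p0 (divr_gt0 p0 p10) qE.
rewrite -powRrM mulrC (mulrC (p - 1)) divfK ?gt_eqF// => young.
have uE := mulr_powRB1 u0 p0.
(* Young's inequality multiplied by [p]: the weight of [u^p], the inverse of [p / (p - 1)], becomes
   [p - 1]. *)
have {young} : p * (u `^ (p - 1) * v) <= v `^ p + (p - 1) * u `^ p.
  apply: (le_trans (ler_wpM2l (ltW p0) young)).
  rewrite le_eqVlt; apply/orP; left; apply/eqP; field.
  by rewrite !gt_eqF.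
rewrite mulrBr -[_ * u]mulrA (mulrC _ u) uE -mulrA; lra.
Qed.

(** The tangent is taken at the larger of the two points, where its slope [p * u^(p-1)] is at most
    [p * D^(p-1)]. *)
Lemma powR_dist_le_mul (R : realType) (p D u v : R) : 1 <= p ->
  0 <= u <= D -> 0 <= v <= D ->
  `|u `^ p - v `^ p| <= p * D `^ (p - 1) * `|u - v|.
Proof.
move=> p1; wlog vu : u v / v <= u => [hw|] /andP[u0 uD] /andP[v0 vD].
  have [/hw|/ltW/hw] := leP v u; first by apply; apply/andP.
  by rewrite (distrC (u `^ p)) (distrC u); apply; apply/andP.
have p0 : 0 <= p by lra.
rewrite !ger0_norm ?subr_ge0//; last by rewrite ge0_ler_powR ?nnegrE.
apply: (le_trans (powR_sub_le_tangent p1 u0 v0)).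
rewrite ler_wpM2r ?subr_ge0// ler_wpM2l// ge0_ler_powR ?nnegrE ?subr_ge0//.
exact: le_trans uD.
Qed.

Section PointSetDist.
Variables (R : realType) (X : metricType R).
Implicit Types (x y z : X) (A : set X).

Lemma point_set_dist_ge0 x A : 0 <= point_set_dist x A.
Proof.
rewrite /point_set_dist; have [->|A0] := eqVneq A set0.
  by rewrite image_set0 inf0.
apply: lb_le_inf; first by apply: image_nonempty; apply/set0P.
by move=> _ [z _ <-]; exact: mdist_ge0.
Qed.

Lemma point_set_dist_le x z A : A z -> point_set_dist x A <= mdist x z.
Proof.
move=> Az; apply: ge_inf; last by exists z.
by exists 0 => _ [w _ <-]; exact: mdist_ge0.
Qed.

Lemma point_set_dist_leD x y A :
  point_set_dist x A <= point_set_dist y A + mdist x y.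
Proof.
(* For empty [A] both distances take the default value 0, and only [0 <= d(x, y)] remains. *)
have [->|/set0P A0] := eqVneq A set0.
  by rewrite /point_set_dist !image_set0 inf0 add0r mdist_ge0.
rewrite -lerBlDr; apply: lb_le_inf; first exact: image_nonempty.
move=> _ [z Az <-]; rewrite lerBlDl.
exact: le_trans (point_set_dist_le x Az) (metric_triangle x y z).
Qed.

Lemma point_set_dist_lipschitz x y A :
  `|point_set_dist x A - point_set_dist y A| <= mdist x y.
Proof.
have hxy := point_set_dist_leD x y A.
have := point_set_dist_leD y x A; rewrite metric_sym => hyx.
rewrite ler_norml; lra.
Qed.

Lemma point_set_dist_le_bound x A (D : R) : 0 <= D ->
  (forall y z, mdist y z <= D) -> point_set_dist x A <= D.
Proof.
move=> D0 hD; have [->|/set0P[z Az]] := eqVneq A set0.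
  by rewrite /point_set_dist image_set0 inf0.
exact: le_trans (point_set_dist_le x Az) (hD x z).
Qed.

Lemma signed_dist_pow_dist_eq (f : X -> R) alpha x y : `|f x| = 1 ->
  f x = f y ->
  `|signed_dist_pow f alpha x - signed_dist_pow f alpha y| =
  `|point_set_dist x (other_class f x) `^ alpha
    - point_set_dist y (other_class f x) `^ alpha|.
Proof.
move=> fx1 fxy; rewrite /signed_dist_pow /other_class -fxy -mulrBr normrM.
by rewrite fx1 mul1r.
Qed.

Lemma signed_dist_pow_dist_neq (f : X -> R) alpha x y : 0 <= alpha ->
  `|f x| = 1 -> `|f y| = 1 -> f x <> f y ->
  `|signed_dist_pow f alpha x - signed_dist_pow f alpha y|
    <= 2 * mdist x y `^ alpha.
Proof.
move=> alpha0 fx1 fy1 fxy; apply: (le_trans (ler_normB _ _)).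
rewrite !normrM fx1 fy1 !mul1r !(ger0_norm (powR_ge0 _ _)).
rewrite mulr_natl mulr2n lerD// ge0_ler_powR ?nnegrE//
  ?point_set_dist_ge0 ?mdist_ge0//.
- by apply: point_set_dist_le => /esym.
- by rewrite metric_sym; exact: point_set_dist_le.
Qed.

End PointSetDist.

Theorem theorem3p1 (R : realType) (X : metricType R) (f : X -> R)
    (hf : forall x : X, f x = -1 \/ f x = 1)
    (alpha : R) (halpha : 0 < alpha)
    (D : R) (hD : 0 < D) (hdD : forall x y : X, mdist x y <= D) :
  forall x y : X,
    (alpha <= 1 ->
       `|signed_dist_pow f alpha x - signed_dist_pow f alpha y|
         <= 2 * mdist x y `^ alpha) /\
    (1 <= alpha ->
       `|signed_dist_pow f alpha x - signed_dist_pow f alpha y|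
         <= 2 * alpha * D `^ (alpha - 1) * mdist x y).
Proof.
move=> x y.
have f1 z : `|f z| = 1 by case: (hf z) => ->; rewrite ?normrN normr1.
have d0 := mdist_ge0 x y.
have [fxy|/eqP fxy] := eqVneq (f x) (f y).
  rewrite (signed_dist_pow_dist_eq alpha (f1 x) fxy).
  set A := other_class f x.
  have lip := point_set_dist_lipschitz x y A.
  split=> halpha1.
    apply: (le_trans (powR_dist_le halpha halpha1 _ _));
      rewrite ?point_set_dist_ge0//.
    apply: (@le_trans _ _ (mdist x y `^ alpha)).
      by rewrite ge0_ler_powR ?nnegrE// ltW.
    by rewrite ler_peMl ?powR_ge0// ler1n.
  have bnd z : 0 <= point_set_dist z A <= D.
    by rewrite point_set_dist_ge0 point_set_dist_le_bound// ltW.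
  apply: (le_trans (powR_dist_le_mul halpha1 (bnd x) (bnd y))).
  have C0 : 0 <= alpha * D `^ (alpha - 1) by rewrite mulr_ge0 ?powR_ge0 ?ltW.
  apply: (le_trans (ler_wpM2l C0 lip)).
  (* Within one class the bound holds already without the factor 2, which is absorbed by
     nonnegativity. *)
  have := mulr_ge0 C0 d0; rewrite -!(mulrA 2); lra.
have le2 := signed_dist_pow_dist_neq (ltW halpha) (f1 x) (f1 y) fxy.
split=> [//|halpha1]; apply: (le_trans le2).
(* With [d = d(x, y)], write [d^alpha = d * d^(alpha-1)]; then [d^(alpha-1) <= D^(alpha-1) <= alpha
   * D^(alpha-1)], as [alpha >= 1]. *)
rewrite -!mulrA ler_wpM2l// -(mulr_powRB1 d0 halpha) mulrC mulrA.
rewrite ler_wpM2r//.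
have le_pow : mdist x y `^ (alpha - 1) <= D `^ (alpha - 1).
  by rewrite ge0_ler_powR ?nnegrE ?subr_ge0// ltW.
by apply: (le_trans le_pow); rewrite ler_peMl// powR_ge0.
Qed.
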